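(* Let $(A,\cdot_A,\delta,D,Q)$ be a commutative and cocommutative differential antisymmetric infinitesimal (ASI) bialgebra. Let $\cdot_{A^*}=\delta^*$ be the dual product on $A^*$, and let $((B,\cdot,D+Q^* ),(A,\cdot_A,D),(A^*,\cdot_{A^*},Q^* ))$ be the corresponding double construction of a commutative differential Frobenius algebra. For $q\in\mathbf{k}$ put $$a\circ_q b=a\cdot_A(D+qQ)(b),\quad \Delta_q(a)=(\mathrm{id}\otimes(Q+qD))\delta(a)\quad(a,b\in A),\qquad f\circ^*_q g=f\cdot_{A^*}(Q^*+qD^* )(g)\quad(f,g\in A^* ),$$ and equip $B$ with the Novikov product $x\circ_q y=x\cdot\big((D+Q^* )+q(Q+D^* )\big)(y)$. (a) For $q=-\frac12$, the Novikov bialgebra $(A,\circ_{-\frac12},\Delta_{-\frac12})$ is precisely the one obtained from the Manin triple of Novikov algebras $(B,(A,\circ_{-\frac12}),(A^*,\circ^*_{-\frac12}))$. (b) If $Q$ is a derivation on $(A,\cdot_A)$ and $D^*$ is a derivation on $(A^*,\cdot_{A^*})$, then the Novikov bialgebra $(A,\circ_q,\Delta_q)$ is precisely the one obtained from the Manin triple of Novikov algebras $(B,(A,\circ_q),(A^*,\circ^*_q))$.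
   Context: $\mathbf{k}$ is a field of characteristic $0$; all vector spaces are over $\mathbf{k}$ and finite-dimensional. $\tau(a\otimes b)=b\otimes a$; $L_*(a)b=a*b$, $R_*(a)b=b*a$. For a linear map $\varphi$, $\varphi^*$ is its transpose: $\langle\varphi^*(f),v\rangle=\langle f,\varphi(v)\rangle$. On $A\oplus A^*$, $D+Q^*$ is $a+f\mapsto D(a)+Q^*(f)$ and $Q+D^*$ is $a+f\mapsto Q(a)+D^*(f)$. Admissible commutative differential algebra $(A,\cdot,D,Q)$: $(A,\cdot)$ commutative associative, $D,Q$ linear, $D(a\cdot b)=D(a)\cdot b+a\cdot D(b)$, $Q(a\cdot b)=Q(a)\cdot b-a\cdot D(b)$. Admissible cocommutative differential coalgebra $(A,\delta,Q,D)$: $\delta$ coassociative, $\delta=\tau\delta$, $\delta Q=(\mathrm{id}\otimes Q+Q\otimes\mathrm{id})\delta$, $\delta D=(D\otimes\mathrm{id}-\mathrm{id}\otimes Q)\delta$. ASI bialgebra $(A,\cdot,\delta)$: $(A,\cdot)$ associative, $(A,\delta)$ coassociative, $\delta(a\cdot b)=(\mathrm{id}\otimes L_\cdot(a))\delta(b)+(R_\cdot(b)\otimes\mathrm{id})\delta(a)$ and $(L_\cdot(b)\otimes\mathrm{id}-\mathrm{id}\otimes R_\cdot(b))\delta(a)+\tau((L_\cdot(a)\otimes\mathrm{id}-\mathrm{id}\otimes R_\cdot(a))\delta(b))=0$. A commutative and cocommutative differential ASI bialgebra $(A,\cdot,\delta,D,Q)$ is one for which $(A,\cdot,\delta)$ is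 an ASI bialgebra, $(A,\cdot,D,Q)$ is an admissible commutative differential algebra and $(A,\delta,Q,D)$ is an admissible cocommutative differential coalgebra. Novikov algebra $(A,\circ)$: $(a\circ b)\circ c-a\circ(b\circ c)=(b\circ a)\circ c-b\circ(a\circ c)$, $(a\circ b)\circ c=(a\circ c)\circ b$; $a\star b:=a\circ b+b\circ a$. Novikov coalgebra $(A,\Delta)$: the transpose $\Delta^*:A^*\otimes A^*\to A^*$ is a Novikov product on $A^*$. Novikov bialgebra $(A,\circ,\Delta)$: Novikov algebra and Novikov coalgebra with, for all $a,b$: $\Delta(a\circ b)=(R_\circ(b)\otimes\mathrm{id})\Delta(a)+(\mathrm{id}\otimes L_\star(a))(\Delta(b)+\tau\Delta(b))$; $(L_\star(a)\otimes\mathrm{id})\Delta(b)-(\mathrm{id}\otimes L_\star(a))\tau\Delta(b)=(L_\star(b)\otimes\mathrm{id})\Delta(a)-(\mathrm{id}\otimes L_\star(b))\tau\Delta(a)$; $(\mathrm{id}\otimes R_\circ(a)-R_\circ(a)\otimes\mathrm{id})(\Delta(b)+\tau\Delta(b))=(\mathrm{id}\otimes R_\circ(b)-R_\circ(b)\otimes\mathrm{id})(\Delta(a)+\tau\Delta(a))$. On $B=A\oplus A^*$ let $\mathcal{B}(a+f,b+g)=\langle f,b\rangle+\langle g,a\rangle$. A Manin triple of Novikov algebras $(B,(A,\circ_A),(A^*,\circ_{A^*}))$ is a Novikov algebra structure $\circ$ on $B=A\oplus A^*$ containing $(A,\circ_A)$ and $(A^*,\circ_{A^*})$ as Novikov subalgebras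 such that $\mathcal{B}(x\circ y,z)=-\mathcal{B}(y,x\star z)$ for all $x,y,z\in B$. Known fact: if $(B,(A,\circ_A),(A^*,\circ_{A^*}))$ is such a Manin triple and $\Delta:A\to A\otimes A$ is the linear dual of $\circ_{A^*}$, i.e. $\langle\Delta(a),f\otimes g\rangle=\langle a,f\circ_{A^*}g\rangle$, then $(A,\circ_A,\Delta)$ is a Novikov bialgebra; this is the Novikov bialgebra ''obtained from the Manin triple''. Double construction of a commutative differential Frobenius algebra $((B,\cdot,D+Q^* ),(A,\cdot_A,D),(A^*,\cdot_{A^*},Q^* ))$: $(B,\cdot)$ is a commutative associative algebra with $B=A\oplus A^*$ as a vector space, containing $(A,\cdot_A)$ and $(A^*,\cdot_{A^*})$ as subalgebras, with $\mathcal{B}(x\cdot y,z)=\mathcal{B}(x,y\cdot z)$, and $D+Q^*$ is a derivation of $(B,\cdot)$. Known fact: if $(A,\cdot_A,\delta,D,Q)$ is a commutative and cocommutative differential ASI bialgebra and $\cdot_{A^*}=\delta^*$, then such a double construction exists; its product is uniquely determined, with $a\cdot f=f\cdot a$ given by $\mathcal{B}(a\cdot f,b+g)=\langle f,a\cdot_A b\rangle+\langle f\cdot_{A^*}g,a\rangle$ for $a,b\in A$, $f,g\in A^*$. Moreover $(B,\cdot,D+Q^*,Q+D^* )$ is then an admissible commutative differential algebra. *)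

(* Defs.v *)
From HB Require Import structures.
From mathcomp Require Import all_boot all_order all_algebra.

Set Implicit Arguments.
Unset Strict Implicit.
Unset Printing Implicit Defensive.

Import GRing.Theory.
Local Open Scope ring_scope.

(* The tensor product of U and V, in coordinates with respect to the bases
   [vbasis {:U}] and [vbasis {:V}].  The choice of bases is invisible through
   [tens] (u, v |-> u (x) v) and [tlift] (the linear map induced by a bilinear
   one), which satisfy the universal property: see [tens_bilinear],
   [tlift_linear], [tlift_tens] and [tlift_unique]. *)
Definition tensor (k : fieldType) (U V : vectType k) : vectType k :=
  'M[k]_(\dim {:U}, \dim {:V}).

Definition bilinear_map (k : fieldType) (U V W : lmodType k)
    (f : U -> V -> W) : Prop :=
  (forall v, linear (f^~ v)) /\ (forall u, linear (f u)).

Section Tensor.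
Variable k : fieldType.
Implicit Types U V W : vectType k.

Definition tens U V (u : U) (v : V) : tensor U V :=
  \matrix_(i, j) (coord (vbasis {:U}) i u * coord (vbasis {:V}) j v).

Definition tlift U V (W : lmodType k) (f : U -> V -> W) (t : tensor U V) : W :=
  \sum_i \sum_j (t : 'M_(_, _)) i j *: f (vbasis {:U})`_i (vbasis {:V})`_j.

Lemma tens_bilinear U V : bilinear_map (@tens U V).
Proof.
split=> [v|u] a x y; apply/matrixP=> i j; rewrite !mxE linearP /=.
  by rewrite mulrDl mulrA.
by rewrite mulrDr mulrCA.
Qed.

Lemma tlift_linear U V (W : lmodType k) (f : U -> V -> W) : linear (tlift f).
Proof.
move=> a s t; rewrite /tlift scaler_sumr -big_split /=; apply: eq_bigr => i _.
rewrite scaler_sumr -big_split /=; apply: eq_bigr => j _.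
by rewrite !mxE scalerDl scalerA.
Qed.

Lemma tlift_tens U V (W : lmodType k) (f : U -> V -> W) (u : U) (v : V) :
  bilinear_map f -> tlift f (tens u v) = f u v.
Proof.
case=> fl fr.
pose gl v := GRing.isLinear.Build _ _ _ _ (f^~ v) (fl v).
pose hl v : {linear U -> W} := HB.pack (f^~ v) (gl v).
pose gr u := GRing.isLinear.Build _ _ _ _ (f u) (fr u).
pose hr u : {linear V -> W} := HB.pack (f u) (gr u).
rewrite [in RHS](coord_vbasis (memvf u)).
rewrite -[RHS]/(hl v _) linear_sum; apply: eq_bigr => i _.
rewrite linearZ /= [in RHS](coord_vbasis (memvf v)).
rewrite -[f _ _]/(hr _ _) linear_sum scaler_sumr; apply: eq_bigr => j _.
by rewrite linearZ /= mxE scalerA.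
Qed.

Lemma tlift_unique U V (W : lmodType k) (f : U -> V -> W) (F : tensor U V -> W) :
  linear F -> (forall u v, F (tens u v) = f u v) -> F =1 tlift f.
Proof.
move=> linF Ff t.
pose gF := GRing.isLinear.Build _ _ _ _ F linF.
pose hF : {linear tensor U V -> W} := HB.pack F gF.
have tensE (i : 'I__) (j : 'I__) :
    tens (vbasis {:U})`_i (vbasis {:V})`_j = delta_mx i j.
  apply/matrixP=> i' j'; rewrite !mxE !coord_free ?(basis_free (vbasisP _)) //.
  by rewrite -natrM mulnb (eq_sym i) (eq_sym j).
rewrite [in LHS](matrix_sum_delta t) -[LHS]/(hF _) linear_sum.
apply: eq_bigr => i _; rewrite linear_sum; apply: eq_bigr => j _.
by rewrite linearZ /= -tensE Ff.
Qed.

Definition tmap U V U' V' (phi : U -> U') (psi : V -> V') :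
    tensor U V -> tensor U' V' :=
  tlift (fun u v => tens (phi u) (psi v)).

Definition tswap U V : tensor U V -> tensor V U :=
  tlift (fun u v => tens v u).

Definition tassoc U V W :
    tensor (tensor U V) W -> tensor U (tensor V W) :=
  tlift (fun t w => tlift (fun u v => tens u (tens v w)) t).

End Tensor.

Notation dualv U := 'Hom(U, GRing.regular _).

Section Dual.
Variable k : fieldType.
Implicit Types U V : vectType k.

Definition transpose U V (phi : 'Hom(U, V)) (f : dualv V) : dualv U :=
  (f \o phi)%VF.

Definition tpair U V (f : dualv U) (g : dualv V) (t : tensor U V) : k :=
  tlift (fun u v => f u * g v : k^o) t.

(* The transpose Delta^* as a binary operation on the dual.  [linfun] yields the
   intended functional when Delta is linear, which all uses of [dual_op]
   assume. *)
Definition dual_op U (Delta : U -> tensor U U) (f g : dualv U) : dualv U :=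
  linfun (fun a => tpair f g (Delta a) : k^o).

End Dual.

Section Differential.
Variables (k : fieldType) (A : vectType k).
Implicit Types (mul : A -> A -> A) (delta : A -> tensor A A).

Record assoc_algebra mul : Prop := AssocAlgebra {
  assoc_bilinear : bilinear_map mul;
  assoc_assoc : associative mul }.

Record derivation mul (D : A -> A) : Prop := Derivation {
  derivation_linear : linear D;
  derivation_leibniz : forall a b, D (mul a b) = mul (D a) b + mul a (D b) }.

Record admissible_comm_diff_algebra mul (D Q : A -> A) : Prop :=
  AdmissibleCommDiffAlgebra {
  acda_assoc : assoc_algebra mul;
  acda_comm : commutative mul;
  acda_derivation : derivation mul D;
  acda_linear : linear Q;
  acda_admissible : forall a b, Q (mul a b) = mul (Q a) b - mul a (D b) }.

Record coassoc_coalgebra delta : Prop := CoassocCoalgebra {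
  coassoc_linear : linear delta;
  coassoc_coassoc : forall a,
    tassoc (tmap delta id (delta a)) = tmap id delta (delta a) }.

Record admissible_cocomm_diff_coalgebra delta (Q D : A -> A) : Prop :=
  AdmissibleCocommDiffCoalgebra {
  acdc_coassoc : coassoc_coalgebra delta;
  acdc_cocomm : forall a, delta a = tswap (delta a);
  acdc_linearQ : linear Q;
  acdc_linearD : linear D;
  acdc_coderivation : forall a,
    delta (Q a) = tmap id Q (delta a) + tmap Q id (delta a);
  acdc_admissible : forall a,
    delta (D a) = tmap D id (delta a) - tmap id Q (delta a) }.

(* [mul a] is the left multiplication L(a), [mul^~ a] is the right
   multiplication R(a). *)
Record asi_bialgebra mul delta : Prop := AsiBialgebra {
  asi_assoc : assoc_algebra mul;
  asi_coassoc : coassoc_coalgebra delta;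
  asi_compat : forall a b,
    delta (mul a b) = tmap id (mul a) (delta b) + tmap (mul^~ b) id (delta a);
  asi_antisym : forall a b,
    (tmap (mul b) id (delta a) - tmap id (mul^~ b) (delta a))
    + tswap (tmap (mul a) id (delta b) - tmap id (mul^~ a) (delta b)) = 0 }.

Record comm_cocomm_diff_asi_bialgebra mul delta (D Q : A -> A) : Prop :=
  CommCocommDiffAsiBialgebra {
  cda_asi : asi_bialgebra mul delta;
  cda_algebra : admissible_comm_diff_algebra mul D Q;
  cda_coalgebra : admissible_cocomm_diff_coalgebra delta Q D }.

End Differential.

Section Novikov.
Variables (k : fieldType) (A : vectType k).
Implicit Types (op : A -> A -> A) (Delta : A -> tensor A A).

Definition star op (a b : A) : A := op a b + op b a.

Record novikov_algebra op : Prop := NovikovAlgebra {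
  novikov_bilinear : bilinear_map op;
  novikov_left_symmetric : forall a b c,
    op (op a b) c - op a (op b c) = op (op b a) c - op b (op a c);
  novikov_right_commutative : forall a b c, op (op a b) c = op (op a c) b }.

End Novikov.

Record novikov_coalgebra (k : fieldType) (A : vectType k)
    (Delta : A -> tensor A A) : Prop := NovikovCoalgebra {
  novikov_co_linear : linear Delta;
  novikov_co_dual : novikov_algebra (dual_op Delta) }.

Record novikov_bialgebra (k : fieldType) (A : vectType k)
    (op : A -> A -> A) (Delta : A -> tensor A A) : Prop := NovikovBialgebra {
  nb_algebra : novikov_algebra op;
  nb_coalgebra : novikov_coalgebra Delta;
  nb_compat1 : forall a b,
    Delta (op a b) = tmap (op^~ b) id (Delta a)
                     + tmap id (star op a) (Delta b + tswap (Delta b));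
  nb_compat2 : forall a b,
    tmap (star op a) id (Delta b) - tmap id (star op a) (tswap (Delta b))
    = tmap (star op b) id (Delta a) - tmap id (star op b) (tswap (Delta a));
  nb_compat3 : forall a b,
    tmap id (op^~ a) (Delta b + tswap (Delta b))
    - tmap (op^~ a) id (Delta b + tswap (Delta b))
    = tmap id (op^~ b) (Delta a + tswap (Delta a))
      - tmap (op^~ b) id (Delta a + tswap (Delta a)) }.

Notation doublev A := (A * dualv A)%type.

Section Double.
Variables (k : fieldType) (A : vectType k).
Implicit Types (mulB opB : doublev A -> doublev A -> doublev A).

Definition dform (x y : doublev A) : k := (x.2 y.1 : k) + y.2 x.1.

Definition dsum (phi : A -> A) (psi : dualv A -> dualv A) (x : doublev A) :
    doublev A := (phi x.1, psi x.2).

Definition extends opB (opA : A -> A -> A) (opAd : dualv A -> dualv A -> dualv A)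
    : Prop :=
  (forall a b, opB (a, 0) (b, 0) = (opA a b, 0)) /\
  (forall f g, opB (0, f) (0, g) = (0, opAd f g)).

Record double_construction mulB (mul : A -> A -> A)
    (muld : dualv A -> dualv A -> dualv A) (D Q : 'End(A)) : Prop :=
  DoubleConstruction {
  dc_assoc : assoc_algebra mulB;
  dc_comm : commutative mulB;
  dc_extends : extends mulB mul muld;
  dc_invariant : forall x y z, dform (mulB x y) z = dform x (mulB y z);
  dc_derivation : derivation mulB (dsum D (transpose Q)) }.

Record manin_triple opB (opA : A -> A -> A)
    (opAd : dualv A -> dualv A -> dualv A) : Prop := ManinTriple {
  mt_novikov : novikov_algebra opB;
  mt_novikovA : novikov_algebra opA;
  mt_novikovAd : novikov_algebra opAd;
  mt_extends : extends opB opA opAd;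
  mt_invariant : forall x y z, dform (opB x y) z = - dform y (star opB x z) }.

Record novikov_bialgebra_of_manin_triple opB (opA : A -> A -> A)
    (opAd : dualv A -> dualv A -> dualv A)
    (op : A -> A -> A) (Delta : A -> tensor A A) : Prop :=
  NovikovBialgebraOfManinTriple {
  nbmt_manin : manin_triple opB opA opAd;
  nbmt_bialgebra : novikov_bialgebra op Delta;
  nbmt_op : forall a b, op a b = opA a b;
  nbmt_dual : forall (a : A) (f g : dualv A),
    tpair f g (Delta a) = opAd f g a }.

End Double.

Definition novikov_op (k : fieldType) (U : vectType k) (mul : U -> U -> U)
    (D Q : U -> U) (q : k) (a b : U) : U := mul a (D b + q *: Q b).

Definition novikov_coop (k : fieldType) (A : vectType k)
    (delta : A -> tensor A A) (D Q : A -> A) (q : k) (a : A) : tensor A A :=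
  tmap id (fun b => Q b + q *: D b) (delta a).

(* Main.v *)
(* Write d = D + Q^* and e = Q + D^* on B = A (+) A^*.  Since e is the adjoint of
   the derivation d for the invariant form, e (x y) = e(x) y - x d(y), so
   x o y = x (d + q e)(y) is a Novikov product for every q; its invariance
   amounts to e (x z) + q d (x z) = - (x o z + z o x).  For q = - 1/2 this is the
   average of the two expressions of e (x z) = e (z x); under (b) it holds
   because s = d + e satisfies s (x) y = s (x y) = 0.
   The axioms of the bialgebra of a Manin triple, paired with f (x) g, become
   instances of B(x o y, z o w) = B(x o w, z o y) with x, y, z, w in A or A^*. *)

From HB Require Import structures.
Require Import Defs.
From mathcomp Require Import all_boot all_order all_algebra.
From mathcomp Require Import ring.

Set Implicit Arguments.
Unset Strict Implicit.
Unset Printing Implicit Defensive.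

Import GRing.Theory.
Local Open Scope ring_scope.

(** * Pairing tensors with pairs of covectors *)

Section TensorPairing.
Variable k : fieldType.
Implicit Types U V : vectType k.

Lemma tpair_bilinear U V (f : dualv U) (g : dualv V) :
  bilinear_map (fun u v => f u * g v : k^o).
Proof.
split=> [v|u] c x y; rewrite linearP /=.
  by rewrite mulrDl -scalerAl.
by rewrite mulrDr -scalerAr.
Qed.

Lemma tpair_linear U V (f : dualv U) (g : dualv V) :
  linear (tpair f g : tensor U V -> k^o).
Proof. exact: tlift_linear. Qed.

HB.instance Definition _ U V (f : dualv U) (g : dualv V) :=
  GRing.isLinear.Build k (tensor U V) k^o _ (tpair f g : tensor U V -> k^o)
    (tpair_linear f g).

Lemma tpair_tens U V (f : dualv U) (g : dualv V) u v :
  tpair f g (tens u v) = f u * g v.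
Proof. by rewrite /tpair tlift_tens //; apply: tpair_bilinear. Qed.

Lemma tpair_tlift U V U' V' (f : dualv U') (g : dualv V')
    (h : U -> V -> tensor U' V') t :
  tpair f g (tlift h t) = tlift (fun u v => tpair f g (h u v) : k^o) t.
Proof.
rewrite /tlift linear_sum; apply: eq_bigr => i _.
by rewrite linear_sum; apply: eq_bigr => j _; rewrite linearZ.
Qed.

(** The maps are bare functions such as [op^~ b], so the transposed functionals [f'] and [g'] are
    supplied from outside and compared pointwise. *)
Lemma tpair_tmap U V U' V' (phi : U -> U') (psi : V -> V')
    (f : dualv U') (g : dualv V') (f' : dualv U) (g' : dualv V) t :
    (forall a, f (phi a) = f' a) -> (forall a, g (psi a) = g' a) ->
  tpair f g (tmap phi psi t) = tpair f' g' t.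
Proof.
move=> ff' gg'; rewrite /tmap tpair_tlift.
by apply: eq_bigr => i _; apply: eq_bigr => j _; rewrite tpair_tens ff' gg'.
Qed.

Lemma tpair_tmapl U V U' (phi : U -> U') (f : dualv U')
    (f' : dualv U) (g : dualv V) t :
    (forall a, f (phi a) = f' a) ->
  tpair f g (tmap phi id t) = tpair f' g t.
Proof. by move=> ff'; apply: tpair_tmap. Qed.

Lemma tpair_tmapr U V V' (psi : V -> V') (f : dualv U)
    (g : dualv V') (g' : dualv V) t :
    (forall a, g (psi a) = g' a) ->
  tpair f g (tmap id psi t) = tpair f g' t.
Proof. by move=> gg'; apply: tpair_tmap. Qed.

Lemma tpair_tswap U V (f : dualv U) (g : dualv V) t :
  tpair f g (tswap t) = tpair g f t.
Proof.
rewrite /tswap tpair_tlift.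
by apply: eq_bigr => i _; apply: eq_bigr => j _; rewrite tpair_tens mulrC.
Qed.

(** Pairing with the coordinate functionals of the two bases reads off the matrix entries. Tensor
    identities can thus be checked after pairing with covectors. *)
Lemma tpair_inj U V (t s : tensor U V) :
  (forall (f : dualv U) (g : dualv V), tpair f g t = tpair f g s) -> t = s.
Proof.
pose e (W : vectType k) i : dualv W := linfun (coord (vbasis {:W}) i : W -> k^o).
have entry r i j : tpair (e U i) (e V j) r = (r : 'M_(_, _)) i j.
  have freeb (W : vectType k) := basis_free (vbasisP {:W}).
  rewrite /tpair /tlift (bigD1 i) //= (bigD1 j) //= !lfunE /= !coord_free //.
  rewrite !eqxx mulr1 /GRing.scale /= mulr1 !big1 ?addr0 // => [i' ne|j' ne].
    rewrite big1 // => j' _; rewrite !lfunE /= !coord_free //.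
    by rewrite (negPf ne) mul0r mulr0.
  by rewrite !lfunE /= !coord_free // (negPf ne) mulr0 mulr0.
by move=> eq_ts; apply/matrixP=> i j; rewrite -!entry eq_ts.
Qed.

Lemma dual_opE (A : vectType k) (Delta : A -> tensor A A) f g a :
  linear Delta -> dual_op Delta f g a = tpair f g (Delta a).
Proof.
move=> linD.
have linp : linear (fun a => tpair f g (Delta a) : k^o).
  by move=> c x y; rewrite linD linearP.
pose gp := GRing.isLinear.Build _ _ _ _ _ linp.
pose p : {linear A -> k^o} := HB.pack (fun a => tpair f g (Delta a) : k^o) gp.
exact: (lfunE p).
Qed.

End TensorPairing.

(** * The symmetric form on the double *)

Section Form.
Variables (k : fieldType) (A : vectType k).
Implicit Types x y z : doublev A.

Lemma dformC x y : dform x y = dform y x.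
Proof. exact: addrC. Qed.

Lemma dform_vec x a : dform x (a, 0) = x.2 a.
Proof. by rewrite /dform zero_lfunE addr0. Qed.

Lemma dform_covec x f : dform x (0, f) = f x.1.
Proof. by rewrite /dform linear0 add0r. Qed.

Lemma dform_linear x : linear (dform x : doublev A -> k^o).
Proof.
move=> c y z; rewrite /dform /= !lfunE /= !linearP /= !lfunE /=.
rewrite /GRing.scale /=; ring.
Qed.

HB.instance Definition _ x :=
  GRing.isLinear.Build k (doublev A) k^o _ (dform x : doublev A -> k^o)
    (dform_linear x).

Lemma dformDr x y z : dform x (y + z) = dform x y + dform x z.
Proof. exact: linearD. Qed.

Lemma dformNr x y : dform x (- y) = - dform x y.
Proof. exact: linearN. Qed.

Lemma dformZr c x y : dform x (c *: y) = c * dform x y.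
Proof. exact: linearZ. Qed.

Lemma dform0l x : dform 0 x = 0.
Proof. by rewrite dformC linear0. Qed.

Lemma dformDl x y z : dform (x + y) z = dform x z + dform y z.
Proof. by rewrite dformC linearD /= dformC [dform z y]dformC. Qed.

Lemma dformBl x y z : dform (x - y) z = dform x z - dform y z.
Proof. by rewrite dformC linearB /= dformC [dform z y]dformC. Qed.

Lemma dformZl c x z : dform (c *: x) z = c * dform x z.
Proof. by rewrite dformC linearZ /= dformC. Qed.

(** Testing against vectors recovers the covector part; testing against coordinate functionals
    recovers the vector part. *)
Lemma dform_nondegenerate x y : (forall z, dform x z = dform y z) -> x = y.
Proof.
case: x y => [a f] [b g] eq_xy; congr pair; last first.
  by apply/lfunP=> c; have := eq_xy (c, 0); rewrite !dform_vec.
apply/eqP; rewrite -subr_eq0; apply/eqP.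
rewrite [LHS](coord_vbasis (memvf _)) big1 // => i _.
have := eq_xy (0, linfun (coord (vbasis {:A}) i : A -> k^o)).
rewrite !dform_covec !lfunE /= => eq_ab.
by rewrite linearB /= eq_ab subrr scale0r.
Qed.

End Form.

(** * Novikov products from admissible differential algebras *)

Section NovikovAlgebras.
Variables (k : fieldType) (A : vectType k).
Implicit Types (op mul : A -> A -> A).

Lemma bilinearDl op (bil : bilinear_map op) a b c :
  op (a + b) c = op a c + op b c.
Proof. by case: bil => lin_op _; rewrite -[a]scale1r lin_op !scale1r. Qed.

Lemma bilinearDr op (bil : bilinear_map op) a b c :
  op a (b + c) = op a b + op a c.
Proof. by case: bil => _ lin_op; rewrite -[b]scale1r lin_op !scale1r. Qed.

Lemma bilinear0l op (bil : bilinear_map op) b : op 0 b = 0.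
Proof. by apply: (addrI (op 0 b)); rewrite -bilinearDl // !addr0. Qed.

Lemma bilinear0r op (bil : bilinear_map op) a : op a 0 = 0.
Proof. by apply: (addrI (op a 0)); rewrite -bilinearDr // !addr0. Qed.

Lemma bilinearZl op (bil : bilinear_map op) c a b :
  op (c *: a) b = c *: op a b.
Proof. by rewrite -[c *: a]addr0 bil.1 bilinear0l // addr0. Qed.

Lemma bilinearZr op (bil : bilinear_map op) c a b :
  op a (c *: b) = c *: op a b.
Proof. by rewrite -[c *: b]addr0 bil.2 bilinear0r // addr0. Qed.

Lemma bilinearBr op (bil : bilinear_map op) a b c :
  op a (b - c) = op a b - op a c.
Proof. by rewrite -scaleN1r bilinearDr // bilinearZr // scaleN1r. Qed.

(** Serves to pass the Novikov identities from the double to its two summands. *)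
Lemma novikov_algebra_inj (B : vectType k) (opB : B -> B -> B)
    (op : A -> A -> A) (iota : A -> B) :
    linear iota -> injective iota ->
    (forall a b, iota (op a b) = opB (iota a) (iota b)) ->
  novikov_algebra opB -> novikov_algebra op.
Proof.
move=> lin_iota inj_iota iotaM [[linl linr] lsym rcomm].
have iotaB a b : iota (a - b) = iota a - iota b.
  by rewrite addrC -scaleN1r lin_iota scaleN1r addrC.
split; first split=> [b|a] c x y; try apply: inj_iota.
- by rewrite !(iotaM, lin_iota) linl.
- by rewrite !(iotaM, lin_iota) linr.
- by move=> a b c; apply: inj_iota; rewrite !iotaB !iotaM.
by move=> a b c; apply: inj_iota; rewrite !iotaM.
Qed.

Lemma novikov_op_admissible mul (D Q : A -> A) (q : k) :
    admissible_comm_diff_algebra mul D Q ->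
  novikov_algebra (novikov_op mul D Q q).
Proof.
case=> [[bil mulA] mulC [linD leibD] linQ admQ].
have mulCA a b c : mul a (mul b c) = mul b (mul a c).
  by rewrite !mulA (mulC a).
have mulAC a b c : mul (mul a b) c = mul (mul a c) b.
  by rewrite -!mulA (mulC b).
pose P b := D b + q *: Q b.
(* With [w = P c] this turns the associator of a, b, c into (q - 1) a b D(P c), which is symmetric
   in a and b. *)
have PM b w : mul (P b) w - P (mul b w) = (q - 1) *: mul b (D w).
  rewrite /P leibD admQ (bilinearDl bil) (bilinearZl bil).
  rewrite scalerBr scalerBl scale1r.
  by rewrite [X in _ - X]addrACA opprD addrA subrr add0r opprB.
split.
- case: (bil) => linl linr; split=> [b|a] c x y; rewrite /novikov_op ?linl //.
  by rewrite linD linQ -linr scalerDr scalerDr !scalerA (mulrC q) addrACA.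
- move=> a b c; rewrite /novikov_op -/(P _) -/(P c) -/(P b).
  rewrite -!mulA -!(bilinearBr bil) !PM !(bilinearZr bil).
  by rewrite mulCA.
by move=> a b c; rewrite /novikov_op mulAC.
Qed.

End NovikovAlgebras.

(** * From a Manin triple to a Novikov bialgebra *)

Section ManinTriple.
Variables (k : fieldType) (A : vectType k).
Variables (opB : doublev A -> doublev A -> doublev A) (opA : A -> A -> A).
Variables (opAd : dualv A -> dualv A -> dualv A) (Delta : A -> tensor A A).
Hypothesis mt : manin_triple opB opA opAd.
Hypothesis linDelta : linear Delta.
Hypothesis dualDelta : forall (a : A) (f g : dualv A),
  tpair f g (Delta a) = opAd f g a.
Implicit Types (a b : A) (f g h : dualv A) (x y z w : doublev A).

(** Right multiplications are self-adjoint: by invariance both sides equal minus the pairing of y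
    with the symmetric product of x and z. *)
Lemma manin_adjoint x y z : dform (opB x y) z = dform x (opB z y).
Proof.
rewrite (mt_invariant mt) [RHS]dformC (mt_invariant mt) /star.
by rewrite [opB x z + _]addrC.
Qed.

(** Moving y across the form yields (z o w) o y, where right commutativity swaps w and y. *)
Lemma manin_exchange x y z w :
  dform (opB x y) (opB z w) = dform (opB x w) (opB z y).
Proof.
by rewrite !manin_adjoint (novikov_right_commutative (mt_novikov mt)).
Qed.

(** The mixed products. Invariance forces their components to be transposes of multiplications in
    the two summands; the next four lemmas identify them. *)
Let L a f := opB (a, 0) (0, f).
Let R f a := opB (0, f) (a, 0).

Lemma manin_left_coadjoint a f b : f (star opA a b) = - (L a f).2 b.
Proof.
have := mt_invariant mt (a, 0) (0, f) (b, 0).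
rewrite /star !(mt_extends mt).1 dform_vec => ->.
by rewrite opprK !linearD /= !dform_vec.
Qed.

Lemma manin_right_coadjoint f a b : f (opA b a) = (R f a).2 b.
Proof.
have := manin_adjoint (0, f) (a, 0) (b, 0).
by rewrite (mt_extends mt).1 !dform_vec.
Qed.

Lemma manin_dual_op f g a : opAd f g a = f (L a g).1.
Proof.
have := manin_adjoint (0, f) (0, g) (a, 0).
by rewrite (mt_extends mt).2 dform_vec dformC dform_covec.
Qed.

Lemma manin_dual_star f g a : opAd f g a + opAd g f a = - g (R f a).1.
Proof.
have := mt_invariant mt (0, f) (a, 0) (0, g).
rewrite dform_covec => ->; rewrite opprK /star linearD /=.
by rewrite !(mt_extends mt).2 !dform_covec.
Qed.

Lemma tpair_Delta_sym f g a :
  tpair f g (Delta a + tswap (Delta a)) = - g (R f a).1.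
Proof. by rewrite linearD /= tpair_tswap !dualDelta manin_dual_star. Qed.

Lemma manin_right_dualC f g a :
  - g (R f a).1 = - f (R g a).1.
Proof. by rewrite -!manin_dual_star addrC. Qed.

Lemma manin_novikov_bialgebra : novikov_bialgebra opA Delta.
Proof.
have dual_opAd f g : dual_op Delta f g = opAd f g.
  by apply/lfunP=> a; rewrite dual_opE.
(* An exchange identity equates two sums of two pairings; the second and third axioms carry the same
   four terms as differences. *)
have rearrange (p s t u : k) : p + s = t + u -> - p - - t = - u - - s.
  move=> eq_pstu; apply/eqP; rewrite !opprK [- p + t]addrC [- u + s]addrC.
  by rewrite subr_eq addrAC eq_sym subr_eq addrC eq_pstu.
have leftE a f b : f (star opA a b) = (- (L a f).2) b.
  by rewrite manin_left_coadjoint !lfunE.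
split.
- exact: mt_novikovA mt.
- split=> //; case: (mt_novikovAd mt) => [[linl linr] lsym rcomm].
  split=> [|f g h|f g h]; rewrite ?dual_opAd //.
  by split=> [g|f] c x y /=; rewrite !dual_opAd ?linl ?linr.
- move=> a b; apply: tpair_inj => f g; rewrite linearD /=.
  rewrite (tpair_tmapl _ _ (manin_right_coadjoint f b)).
  rewrite (tpair_tmapr _ _ (leftE a g)).
  rewrite tpair_Delta_sym !dualDelta (manin_dual_op (R f b).2) opp_lfunE opprK.
  (* The first axiom is B(f o g, a o b) = B(f o b, a o g). *)
  have := manin_exchange (0, f) (0, g) (a, 0) (b, 0).
  by rewrite (mt_extends mt).1 (mt_extends mt).2 dform_vec /= => ->.
- move=> a b; apply: tpair_inj => f g; rewrite !linearB /=.
  rewrite !(tpair_tmapl _ _ (leftE _ _)).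
  rewrite !(tpair_tmapr _ _ (leftE _ _)) !tpair_tswap !dualDelta.
  rewrite !manin_dual_op !opp_lfunE.
  (* The second axiom is B(a o f, b o g) = B(a o g, b o f). *)
  have := manin_exchange (a, 0) (0, f) (b, 0) (0, g).
  by rewrite -!/(L _ _) /dform => /rearrange.
move=> a b; apply: tpair_inj => f g; rewrite !linearB /=.
rewrite !(tpair_tmapl _ _ (manin_right_coadjoint _ _)).
rewrite !(tpair_tmapr _ _ (manin_right_coadjoint _ _)).
(* Symmetry in the two covectors brings the terms paired through [g] to the shape found in B(f o b,
   g o a) = B(f o a, g o b). *)
rewrite !tpair_Delta_sym ![- g _]manin_right_dualC.
have := manin_exchange (0, f) (b, 0) (0, g) (a, 0).
by rewrite -!/(R _ _) /dform addrC => /rearrange.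
Qed.

End ManinTriple.

(** * Invariance of the Novikov product on the double *)

Section DoubleConstruction.
Variables (k : fieldType) (A : vectType k).
Variables (mulB : doublev A -> doublev A -> doublev A) (mul : A -> A -> A).
Variables (muld : dualv A -> dualv A -> dualv A) (D Q : 'End(A)).
Hypothesis dc : double_construction mulB mul muld D Q.
Implicit Types (a b : A) (f g : dualv A) (x y z : doublev A) (q : k).

Local Notation d := (dsum D (transpose Q)).
Local Notation e := (dsum Q (transpose D)).

Lemma dsum_transpose_linear (phi psi : 'End(A)) :
  linear (dsum phi (transpose psi)).
Proof.
move=> c x y; rewrite /dsum linearP; congr pair.
by apply/lfunP=> a; rewrite !lfunE /= !lfunE /= !lfunE.
Qed.

Lemma dsum_vec (phi psi : 'End(A)) a :
  dsum phi (transpose psi) (a, 0) = (phi a, 0).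
Proof. by rewrite /dsum /transpose comp_lfun0l. Qed.

Lemma dsum_covec (phi psi : 'End(A)) f :
  dsum phi (transpose psi) (0, f) = (0, transpose psi f).
Proof. by rewrite /dsum linear0. Qed.

Lemma dsum_transpose_adjoint (phi psi : 'End(A)) x y :
  dform (dsum phi (transpose psi) x) y = dform x (dsum psi (transpose phi) y).
Proof. by rewrite /dform /dsum /transpose /= !comp_lfunE. Qed.

Let bilB : bilinear_map mulB := assoc_bilinear (dc_assoc dc).

(* [e] is the adjoint of the derivation [d] for the invariant form. *)
Lemma double_admissible : admissible_comm_diff_algebra mulB d e.
Proof.
split.
- exact: dc_assoc dc.
- exact: dc_comm dc.
- exact: dc_derivation dc.
- exact: dsum_transpose_linear.
move=> x y; apply: dform_nondegenerate => z.
rewrite dsum_transpose_adjoint (dc_invariant dc).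
rewrite dformBl !(dc_invariant dc) dsum_transpose_adjoint.
by rewrite (derivation_leibniz (dc_derivation dc)) linearD /=
  addrAC subrr add0r.
Qed.

(** B(x P(y), z) = B(y, P'(x z)), where P = d + q e has adjoint P' = e + q d. *)
Lemma double_novikov_invariant q :
    (forall x z, e (mulB x z) + q *: d (mulB x z)
                 = - star (novikov_op mulB d e q) x z) ->
  forall x y z, dform (novikov_op mulB d e q x y) z
                = - dform y (star (novikov_op mulB d e q) x z).
Proof.
move=> adj x y z; rewrite {1}/novikov_op (dc_comm dc) (dc_invariant dc).
by rewrite -dformNr -adj dformDr dformZr dformDl dformZl
  !dsum_transpose_adjoint.
Qed.

Lemma double_novikov_adjoint_half :
    (2%:R : k) != 0 -> forall x z,
    e (mulB x z) + (- (1 / 2)) *: d (mulB x z)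
    = - star (novikov_op mulB d e (- (1 / 2))) x z.
Proof.
move=> two_neq0 x z.
have [_ mulC [_ leib] _ adm] := double_admissible.
pose h : k := 1 / 2.
have halves (w : doublev A) : w = h *: w + h *: w.
  by rewrite -scalerDl -mulrDl -[1 + 1]/(2%:R) divff // scale1r.
(* Average of e(x z) = e(x) z - x d(z) and e(z x) = e(z) x - z d(x). *)
have eE : e (mulB x z) =
    h *: (mulB z (e x) + mulB x (e z)) - h *: (mulB z (d x) + mulB x (d z)).
  rewrite [LHS]halves {2}[mulB x z]mulC !adm (mulC (e x)) (mulC (e z)).
  by rewrite -scalerDr -scalerBr addrACA -opprD [mulB x (d z) + _]addrC.
(* The Leibniz expansion of - 1/2 d(x z) doubles the d-terms of the average, so they get coefficient
   - 1 while the e-terms keep 1/2. *)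
rewrite eE leib (mulC (d x)) scaleNr -addrA -opprD -halves.
rewrite /star /novikov_op !(bilinearDr bilB) !(bilinearZr bilB) !scaleNr.
by rewrite addrACA -opprD -scalerDr opprB ![mulB x _ + _]addrC.
Qed.

Section Derivations.
Hypothesis derQ : derivation mul Q.
Hypothesis derDt : derivation muld (transpose D).

Let s x := d x + e x.

(** The term x d(y) of the Leibniz rule cancels against the admissibility of e. *)
Lemma double_sM x y : s (mulB x y) = mulB (s x) y.
Proof.
have [_ _ [_ leib] _ adm] := double_admissible.
by rewrite /s leib adm (bilinearDl bilB) addrACA subrr addr0.
Qed.

(** Equals both B(s(x y), z) and B(s(x), y z), whence the symmetries [TC] and [TA]. *)
Let T x y z := dform (mulB (s x) y) z.

Let TC x y z : T x y z = T y x z.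
Proof. by rewrite /T -!double_sM (dc_comm dc). Qed.

Let TA x y z : T x y z = T x z y.
Proof. by rewrite /T !(dc_invariant dc) (dc_comm dc). Qed.

(** Admissibility gives e(y x) = e(y) x - y d(x); comparing it with the Leibniz rule leaves y (d(x)
    + e(x)) = 0. *)
Lemma double_s_leibniz x y :
  e (mulB y x) = mulB (e y) x + mulB y (e x) -> mulB (s x) y = 0.
Proof.
have [_ mulC _ _ adm] := double_admissible.
rewrite adm [mulB (s x) y]mulC (bilinearDr bilB) => /addrI <-.
by rewrite addrN.
Qed.

(** On A the map e restricts to Q, a derivation by assumption; on the dual it restricts to
    [transpose D], which gives the next lemma. *)
Lemma double_s_vec a b : mulB (s (a, 0)) (b, 0) = 0.
Proof.
apply: double_s_leibniz; rewrite !dsum_vec !(dc_extends dc).1 dsum_vec.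
by rewrite (derivation_leibniz derQ); congr pair; rewrite addr0.
Qed.

Lemma double_s_covec f g : mulB (s (0, f)) (0, g) = 0.
Proof.
apply: double_s_leibniz; rewrite !dsum_covec !(dc_extends dc).2 dsum_covec.
by rewrite (derivation_leibniz derDt); congr pair; rewrite addr0.
Qed.

(* [T x y z] is symmetric and trilinear, and two of any three homogeneous
   arguments lie in the same summand of [A (+) A^*]. *)
Lemma double_s_eq0 x y : mulB (s x) y = 0.
Proof.
have T0v a b z : T (a, 0) (b, 0) z = 0.
  by rewrite /T double_s_vec dform0l.
have T0c f g z : T (0, f) (0, g) z = 0.
  by rewrite /T double_s_covec dform0l.
have TD u v w t : T u (v + w) t = T u v t + T u w t.
  by rewrite /T (bilinearDr bilB) dformDl.
have split_pair (u : doublev A) : u = (u.1, 0) + (0, u.2).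
  by case: u => a f; congr pair; rewrite /= ?addr0 ?add0r.
have T0m a f z : T (a, 0) (0, f) z = 0.
  by rewrite TA (split_pair z) TD T0v add0r TC TA T0c.
apply: dform_nondegenerate => z; rewrite dform0l -/(T x y z).
rewrite (split_pair y) TD !(TC x) (split_pair x) !TD T0v T0c T0m.
by rewrite TC T0m !addr0.
Qed.

(** Since e acts as - d on products and inside products, both sides equal (q - 1) d(x z). *)
Lemma double_novikov_adjoint_derivation q x z :
  e (mulB x z) + q *: d (mulB x z) = - star (novikov_op mulB d e q) x z.
Proof.
have [_ mulC [_ leib] _ adm] := double_admissible.
have eE y w : mulB y (e w) = - mulB y (d w).
  apply/eqP; rewrite -addr_eq0 addrC -(bilinearDr bilB) mulC.
  by rewrite double_s_eq0.
have -> : e (mulB x z) = - d (mulB x z).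
  by apply/eqP; rewrite -addr_eq0 addrC -/(s _) double_sM double_s_eq0.
rewrite /star /novikov_op !(bilinearDr bilB) !(bilinearZr bilB) !eE leib.
rewrite (mulC (d x)) !scalerN addrACA -opprD -scalerDr opprB.
rewrite ![mulB z _ + _]addrC.
exact: addrC.
Qed.

End Derivations.

End DoubleConstruction.

(** * Duality of the coproduct and assembly of the Manin triple *)

(** Transposing id (x) (Q + q D) moves the operator onto the second covector, so D and Q exchange
    roles on the dual. *)
Lemma dual_novikov_coop (k : fieldType) (A : vectType k)
    (delta : A -> tensor A A) (D Q : 'End(A)) (q : k) (a : A) (f g : dualv A) :
    linear delta ->
  tpair f g (novikov_coop delta D Q q a)
  = novikov_op (dual_op delta) (transpose Q) (transpose D) q f g a.
Proof.
move=> lin_delta; rewrite /novikov_op dual_opE // /novikov_coop.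
apply: tpair_tmapr => b.
by rewrite linearD linearZ /= add_lfunE scale_lfunE !comp_lfunE.
Qed.

Lemma novikov_coop_linear (k : fieldType) (A : vectType k)
    (delta : A -> tensor A A) (D Q : A -> A) (q : k) :
  linear delta -> linear (novikov_coop delta D Q q).
Proof.
by move=> lin_delta c x y; rewrite /novikov_coop lin_delta /tmap tlift_linear.
Qed.

Lemma vec_linear (k : fieldType) (A : vectType k) :
  linear (fun a : A => (a, 0) : doublev A).
Proof. by move=> c a b; congr pair; rewrite /= scaler0 addr0. Qed.

Lemma covec_linear (k : fieldType) (A : vectType k) :
  linear (fun f : dualv A => (0, f) : doublev A).
Proof. by move=> c f g; congr pair; rewrite /= scaler0 addr0. Qed.

(** Both d and e preserve the two summands, which are therefore Novikov subalgebras of the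
    double. *)
Lemma double_manin_triple (k : fieldType) (A : vectType k)
    (mulB : doublev A -> doublev A -> doublev A) (mul : A -> A -> A)
    (muld : dualv A -> dualv A -> dualv A) (D Q : 'End(A)) (q : k) :
    let d := dsum D (transpose Q) in let e := dsum Q (transpose D) in
    double_construction mulB mul muld D Q ->
    (forall x z, e (mulB x z) + q *: d (mulB x z)
                 = - star (novikov_op mulB d e q) x z) ->
  manin_triple (novikov_op mulB d e q) (novikov_op mul D Q q)
    (novikov_op muld (transpose Q) (transpose D) q).
Proof.
move=> d e dc adj.
have novB := novikov_op_admissible q (double_admissible dc).
have [extA extAd] : extends (novikov_op mulB d e q) (novikov_op mul D Q q)
    (novikov_op muld (transpose Q) (transpose D) q).
  rewrite /novikov_op /d /e; split=> [a b|f g].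
    rewrite !dsum_vec -(dc_extends dc).1; congr mulB.
    by congr pair; rewrite /= scaler0 addr0.
  rewrite !dsum_covec -(dc_extends dc).2; congr mulB.
  by congr pair; rewrite /= scaler0 addr0.
split=> //.
- by apply: (novikov_algebra_inj (@vec_linear k A)) novB => [a b []|a b].
- by apply: (novikov_algebra_inj (@covec_linear k A)) novB => [f g []|f g].
exact: (double_novikov_invariant dc adj).
Qed.

Theorem proposition2p40 (k : fieldType) (chark0 : [pchar k] =i pred0)
    (A : vectType k) (mul : A -> A -> A) (delta : A -> tensor A A)
    (D Q : 'End(A)) (mulB : doublev A -> doublev A -> doublev A)
    (asi : comm_cocomm_diff_asi_bialgebra mul delta D Q)
    (dc : double_construction mulB mul (dual_op delta) D Q) :
  let opA q := novikov_op mul D Q q in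
  let Deltaq q := novikov_coop delta D Q q in
  let opAd q := novikov_op (dual_op delta) (transpose Q) (transpose D) q in
  let opB q :=
    novikov_op mulB (dsum D (transpose Q)) (dsum Q (transpose D)) q in
  let obtained q :=
    novikov_bialgebra_of_manin_triple
      (opB q) (opA q) (opAd q) (opA q) (Deltaq q) in
  obtained (- (1 / 2))
  /\ (derivation mul Q -> derivation (dual_op delta) (transpose D) ->
      forall q : k, obtained q).
Proof.
move=> opA Deltaq opAd opB obtained.
have lin_delta := coassoc_linear (acdc_coassoc (cda_coalgebra asi)).
have dual_Delta q a f g := dual_novikov_coop D Q q a f g lin_delta.
(* Both parts reduce to the Manin triple, hence to the adjoint identity for the given q. *)
have manin_obtained q : manin_triple (opB q) (opA q) (opAd q) -> obtained q.
  move=> mt; split=> //.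
  apply: (manin_novikov_bialgebra mt) => //.
  exact: novikov_coop_linear.
split.
  apply/manin_obtained/double_manin_triple => //.
  apply: (double_novikov_adjoint_half dc).
  (* As 2 is prime, its vanishing in [k] would make it the characteristic. *)
  by have := chark0 2%N; rewrite !inE /= => ->.
move=> derQ derDt q; apply/manin_obtained/double_manin_triple => //.
exact: double_novikov_adjoint_derivation dc derQ derDt q.
Qed.
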